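(* Let $G=(V,E)$ be a finite simple graph with vertices $v_1,\dots,v_n$, and assign to each edge $\{v_i,v_j\}\in E$ the weight $\omega_{i,j}=x_ix_j$, where $x_1,\dots,x_n$ are indeterminates (so $x_i$ is attached to $v_i$). Then there exist an ordering of the vertices (i.e., a simultaneous permutation of the rows and columns of the weighted Laplacian $L(G;\omega)$) and a rank-one matrix $M$ with entries in $\mathbb{R}(x_1,\dots,x_n)$ such that the reordered $L(G;\omega)+M$ is upper triangular, if and only if $G$ is special $2$-threshold.
   Context: Graphs are finite, without loops or parallel edges. The weighted degree is $\deg(v_i;\omega)=\sum_{\{v_i,v_j\}\in E}\omega_{i,j}$. The weighted Laplacian $L(G;\omega)$ is the $n\times n$ matrix with $(i,i)$ entry $\deg(v_i;\omega)$, $(i,j)$ entry $-\omega_{i,j}$ if $\{v_i,v_j\}\in E$, and $0$ otherwise. For $v\in V$ and $W\subseteq V$, $N_W(v)$ is the set of neighbors of $v$ in $W$. For $U\subseteq V$, $G$ is $U$-threshold if for every nonempty $W\subseteq V$ the induced subgraph $G[W]$ contains a vertex $v$ with $N_W(v)=\emptyset$ or $N_W(v)=(W\setminus\{v\})\cap U$; $G$ is special $2$-threshold if it is $U$-threshold for some $U\subseteq V$. *)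

(* Defs.v *)
From HB Require Import structures.
From mathcomp Require Import all_boot all_order all_fingroup all_algebra.
From mathcomp Require Import reals.
From mathcomp Require Import mpoly.

Set Implicit Arguments.
Unset Strict Implicit.
Unset Printing Implicit Defensive.

Import GRing.Theory.

Local Open Scope ring_scope.

(* A finite simple graph on a vertex set [T] is a symmetric and irreflexive
   adjacency relation [e : rel T]. *)

Section Threshold.
Variables (T : finType) (e : rel T).

Definition nbhd_in (W : {set T}) (v : T) : {set T} := [set w in W | e v w].

Definition threshold_wrt (U : {set T}) : Prop :=
  forall W : {set T}, W != set0 ->
    exists2 v, v \in W &
      nbhd_in W v = set0 \/ nbhd_in W v = (W :\ v) :&: U.

Definition special_2_threshold : Prop := exists U : {set T}, threshold_wrt U.

End Threshold.

Section Laplacian.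
Variables (F : zmodType) (n : nat) (e : rel 'I_n) (w : 'I_n -> 'I_n -> F).

Definition weighted_degree (i : 'I_n) : F := \sum_(j | e i j) w i j.

Definition weighted_laplacian : 'M[F]_n :=
  \matrix_(i, j) (if i == j then weighted_degree i
                  else if e i j then - w i j else 0).

End Laplacian.

(* The library's [is_trig_mx] means lower triangular. *)
Definition is_upper_trig_mx (F : nmodType) (n : nat) (A : 'M[F]_n) : bool :=
  is_trig_mx A^T.

(* R(x_1, ..., x_n) is the fraction field of the polynomial ring
   R[x_1, ..., x_n], in which x_i is the image of the monomial ['X_i]. *)
Definition indet (R : realType) (n : nat) (i : 'I_n) :
    {fraction {mpoly R[n]}} :=
  @tofrac {mpoly R[n]} 'X_i.

(* Main.v *)
(* Dividing the strictly lower entries of L + M = 0 by the weights x_i x_j shows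
   that L + M can be made upper triangular by a rank-one M exactly when, for some
   ordering, the strictly lower part of the adjacency matrix is that of an outer
   product, which may be taken to be 1_A 1_U^T. Read from the last vertex down,
   such an ordering is an elimination order witnessing that G is U-threshold:
   the eliminated vertex is isolated when it is outside A and is adjacent to
   exactly the remaining vertices of U when it is in A. *)
Require Import Defs.
From HB Require Import structures.
From mathcomp Require Import all_boot all_order all_fingroup all_algebra.
From mathcomp Require Import reals.
From mathcomp Require Import mpoly.

Set Implicit Arguments.
Unset Strict Implicit.
Unset Printing Implicit Defensive.

Import GRing.Theory.

Local Open Scope ring_scope.

(** Induction on [#|W|]: the vertex [v] that the threshold property provides for [W] goes last,
    after a sequence for [W :\ v]. The vertices before [v] are then exactly [W :\ v], so its
    neighborhood in [W] is read off from them. *)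
Lemma threshold_elimination_seq (T : finType) (e : rel T) (U : {set T})
    (x0 : T) (W : {set T}) :
  threshold_wrt e U ->
  exists p : seq T, [/\ uniq p, p =i W &
    forall k, (k < size p)%N ->
      {in take k p, forall j, ~~ e (nth x0 p k) j} \/
      {in take k p, forall j, e (nth x0 p k) j = (j \in U)}].
Proof.
move=> thr; elim: {W}#|W| {-2}W (erefl #|W|) => [|m IHm] W cardW.
  exists [::]; split=> // j; by rewrite (cards0_eq cardW) inE.
have /thr[v vW Nv] : W != set0 by rewrite -card_gt0 cardW.
have cardWv : #|W :\ v| = m by move: cardW; rewrite (cardsD1 v W) vW => -[].
have [p [p_uniq pW p_elim]] := IHm _ cardWv.
exists (rcons p v); split.
- by rewrite rcons_uniq pW !inE eqxx.
- by move=> j; rewrite mem_rcons inE pW !inE; case: eqP => [->|].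
move=> k; rewrite size_rcons ltnS leq_eqVlt => /predU1P[->|lt_k].
  rewrite nth_rcons ltnn eqxx -cats1 take_size_cat //.
  case: Nv => /setP Nv; [left|right] => j; rewrite pW => jWv;
    by have := Nv j; move: jWv; rewrite !inE => /andP[jv jW];
    rewrite ?jv ?jW /= => ->.
by rewrite nth_rcons lt_k -cats1 takel_cat ?(ltnW lt_k) //; apply: p_elim.
Qed.

Lemma threshold_wrtP (n : nat) (e : rel 'I_n) (U : {set 'I_n}) :
  irreflexive e ->
  threshold_wrt e U <->
  exists (s : 'S_n) (A : {set 'I_n}), forall i j : 'I_n, (j < i)%N ->
    e (s i) (s j) = (s i \in A) && (s j \in U).
Proof.
move=> e_irr; split=> [thr | [s [A sA]] W /set0Pn[w wW]]; last first.
  have sw : s ((s^-1)%g w) \in W by rewrite permKV.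
  (* Take the vertex of [W] in the last position: all others in [W] precede it, so [sA] determines
     its whole neighborhood in [W]. *)
  case: (@arg_maxnP _ _ (fun i => s i \in W) (@nat_of_ord n) sw) => i iW i_max.
  have eE j : j \in W -> j != s i -> e (s i) j = (s i \in A) && (j \in U).
    rewrite -[j](permKV s) (inj_eq perm_inj) => jW ji; apply: sA.
    by rewrite ltn_neqAle val_eqE ji; apply: i_max.
  exists (s i) => //; case: (boolP (s i \in A)) => iA; [right|left];
    apply/setP=> j; rewrite !inE; case: (eqVneq j (s i)) => [->|ji];
    rewrite ?e_irr ?andbF //=; case: (boolP (j \in W)) => //= jW;
    by rewrite eE ?iA ?(negPf iA).
case: n e U e_irr thr => [|n] e U _ thr.
  by exists 1%g, set0 => -[].
have [p [p_uniq pT p_elim]] := threshold_elimination_seq ord0 setT thr.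
have size_p : size p = n.+1.
  by rewrite -(card_uniqP p_uniq) (eq_card pT) cardsT card_ord.
have f_inj : injective (fun i : 'I_n.+1 => nth ord0 p i).
  by move=> i j /eqP; rewrite nth_uniq ?size_p // => /eqP/val_inj.
pose s := perm f_inj.
have s_take (i j : 'I_n.+1) : (j < i)%N -> s j \in take i p.
  move=> ji; rewrite permE -(nth_take _ ji); apply: mem_nth.
  by rewrite size_takel // size_p ltnW.
(* The two alternatives in [p_elim] overlap when no earlier vertex lies in [U]. Having an earlier
   neighbor is a decidable criterion that agrees with either of them. *)
pose A := [set v | [exists i : 'I_n.+1, (v == s i) && has (e v) (take i p)]].
exists s, A => i j ji; have jp := s_take _ _ ji.
have -> : (s i \in A) = has (e (s i)) (take i p).
  rewrite inE; apply/existsP/idP => [[k]|]; last by exists i; rewrite eqxx.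
  by rewrite (inj_eq perm_inj) => /andP[/eqP <-].
have [|none|all_U] := p_elim i; rewrite ?size_p //.
  rewrite permE (negPf (none _ jp)); symmetry; apply/negbTE.
  by rewrite negb_and -all_predC; apply/orP; left; apply/allP.
rewrite [s i]permE all_U //; case: (boolP (s j \in U)) => jU;
  rewrite ?andbF // andbT.
by symmetry; apply/hasP; exists (s j); rewrite ?all_U.
Qed.

(** The full-rank factorization of [M] has inner dimension 1, so it is a column times a row. *)
Lemma mxrank1_outer (F : fieldType) (m n : nat) (M : 'M[F]_(m, n)) :
  \rank M = 1%N -> exists u v, forall i j, M i j = u i * v j.
Proof.
move=> rkM; move: (col_base M) (row_base M) (mulmx_base M); rewrite rkM => C D <-.
by exists (C^~ 0), (D 0) => i j; rewrite mxE big_ord1.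
Qed.

Lemma mxrank_outer (F : fieldType) (m n : nat) (u : 'I_m -> F) (v : 'I_n -> F)
    (i0 : 'I_m) (j0 : 'I_n) :
  u i0 * v j0 != 0 -> \rank (\matrix_(i, j) (u i * v j)) = 1%N.
Proof.
move=> uv0; apply/eqP; rewrite eqn_leq lt0n mxrank_eq0; apply/andP; split.
  have -> : \matrix_(i, j) (u i * v j) = (\col_i u i) *m (\row_j v j).
    by apply/matrixP=> i j; rewrite !mxE big_ord1 !mxE.
  exact: mulmx_max_rank.
by apply: contraNneq uv0 => /matrixP/(_ i0 j0); rewrite !mxE => ->.
Qed.

(** Triangularity leaves the diagonal free, so the degrees never have to be computed; the
    indeterminates enter only as nonzero scalars. *)
Lemma upper_trig_rank1P (F : fieldType) (n : nat) (n_gt0 : (0 < n)%N)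
    (e : rel 'I_n) (x : 'I_n -> F) (s : 'S_n) : (forall i, x i != 0) ->
  let L := weighted_laplacian e (fun i j => x i * x j) in
  (exists M : 'M[F]_n,
     \rank M = 1%N /\ is_upper_trig_mx (row_perm s (col_perm s L) + M)) <->
  exists A U : {set 'I_n}, forall i j : 'I_n, (j < i)%N ->
    e (s i) (s j) = (s i \in A) && (s j \in U).
Proof.
move=> x0 L.
have LE (i j : 'I_n) : (j < i)%N -> row_perm s (col_perm s L) i j =
    - (if e (s i) (s j) then x (s i) * x (s j) else 0).
  move=> ji; rewrite !mxE (inj_eq perm_inj) -val_eqE gtn_eqF //.
  by case: ifP; rewrite ?oppr0.
split=> [[M [/mxrank1_outer[u [v Muv]] /is_trig_mxP trig]] | [A [U AU]]].
  (* The supports of [u] and [v], moved to vertices by [s]: below the diagonal [u i * v j] is the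
     edge weight, or 0 for a non-edge, and edge weights are nonzero. *)
  exists [set s i | i : 'I_n & u i != 0], [set s j | j : 'I_n & v j != 0].
  move=> i j ji; rewrite !(mem_imset _ _ perm_inj) !inE.
  have := trig j i ji; rewrite mxE [LHS]mxE LE // Muv => /eqP.
  rewrite addrC subr_eq0 -negb_or -mulf_eq0 => /eqP ->.
  by case: (e _ _); rewrite ?eqxx // mulf_neq0.
case: n n_gt0 e x s x0 @L LE A U AU => // n _ e x s x0 L LE A U AU.
(* Row 0 and the last column lie outside the strictly lower triangle, so the
   corresponding coefficients are free; they keep M nonzero on edgeless graphs. *)
pose u (i : 'I_n.+1) := if (i == ord0) || (s i \in A) then x (s i) else 0.
pose v (j : 'I_n.+1) := if (j == ord_max) || (s j \in U) then x (s j) else 0.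
exists (\matrix_(i, j) (u i * v j)); split.
  by apply: (@mxrank_outer _ _ _ _ _ ord0 ord_max); rewrite /u /v !eqxx mulf_neq0.
apply/is_trig_mxP => j i ji; rewrite mxE [LHS]mxE LE // AU // mxE /u /v.
have -> : (i == ord0) = false by rewrite -val_eqE gtn_eqF // (leq_ltn_trans _ ji).
have -> : (j == ord_max) = false.
  by rewrite -val_eqE ltn_eqF // (leq_trans ji) // -ltnS.
by case: (s i \in A); case: (s j \in U);
  rewrite /= ?mulr0 ?mul0r ?addNr ?oppr0 ?addr0.
Qed.

Theorem theorem4p5 (R : realType) (n : nat) (n_gt0 : (0 < n)%N)
    (e : rel 'I_n) (e_sym : ssrbool.symmetric e) (e_irr : irreflexive e) :
  let L : 'M[{fraction {mpoly R[n]}}]_n :=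
    weighted_laplacian e (fun i j => indet R i * indet R j) in
  (exists (s : 'S_n) (M : 'M[{fraction {mpoly R[n]}}]_n),
     \rank M = 1%N /\ is_upper_trig_mx (row_perm s (col_perm s L) + M))
  <-> special_2_threshold e.
Proof.
have x0 i : indet R i != 0 :> {fraction {mpoly R[n]}}.
  by rewrite /indet tofrac_eq0 -msupp_eq0 msuppX.
split=> [[s /(upper_trig_rank1P n_gt0 e s x0)[A [U AU]]] | [U]].
  by exists U; apply/threshold_wrtP => //; exists s, A.
move=> /(threshold_wrtP _ e_irr)[s [A AU]]; exists s.
by apply/(upper_trig_rank1P n_gt0 e s x0); exists A, U.
Qed.
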